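(* Let $F\subseteq\mathbb{R}^d$ be a non-empty compact set. Let $\Phi=\{\varphi_i\}_{i\in\Lambda}$ be a similarity IFS and let $T\in\mathcal{T}'_\Lambda$ be a tree without leaves such that $F=\Gamma_\Phi(T)$. Then every miniset $M$ of a member of $\overline{\mathcal{S}_\Phi^T}$ is contained in a microset of $F$. Moreover, if $M$ has the form $M=Q\cap\psi(A)$ for some $A\in\overline{\mathcal{S}_\Phi^T}$ and an expanding similarity map $\psi$, and $\Phi$ satisfies the open set condition (OSC) with an OSC set $U$ such that $\psi^{-1}(Q)\subseteq U$, then $M$ is a microset of $F$.
   Context: $Q=[0,1]^d$ is the closed unit cube. A similarity map is a map $\varphi:\mathbb{R}^d\to\mathbb{R}^d$ with $\|\varphi(x)-\varphi(y)\|=r\|x-y\|$ for all $x,y$, for some $r>0$; it is contracting if $r<1$ and expanding if $r\ge1$. For a compact $F\subseteq\mathbb{R}^d$, a miniset of $F$ is a non-empty set of the form $Q\cap\varphi(F)$ with $\varphi$ an expanding similarity; a microset of $F$ is any limit of a sequence of minisets of $F$ in the Hausdorff metric. A similarity IFS is a finite non-empty collection $\Phi=\{\varphi_i\}_{i\in\Lambda}$ of contracting similarity maps of $\mathbb{R}^d$. The coding map $\gamma_\Phi:\Lambda^{\mathbb{N}}\to\mathbb{R}^d$ is $\gamma_\Phi(i)=\lim_{n\to\infty}\varphi_{i_1}\circ\dots\circ\varphi_{i_n}(0)$. A tree with alphabet $\Lambda$ is a set $T\subseteq\Lambda^*=\bigcup_{n\ge0}\Lambda^n$ containing the empty word and closed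 under taking prefixes; its boundary is $\partial T=\{i\in\Lambda^{\mathbb{N}}: i_1\dots i_n\in T\ \forall n\}$. $\mathcal{T}'_\Lambda$ is the set of trees with alphabet $\Lambda$ without leaves (every $v\in T$ has some $j\in\Lambda$ with $vj\in T$). For a tree $T$ with non-empty boundary, $\Gamma_\Phi(T)=\gamma_\Phi(\partial T)$. For $v\in T$, $T^v=\{w\in\Lambda^*: vw\in T\}$. Put $\mathcal{S}_\Phi^T=\{\Gamma_\Phi(T^v): v\in T\}$, and let $\overline{\mathcal{S}_\Phi^T}$ be its closure in the Hausdorff metric. $\Phi$ satisfies the OSC if there is a non-empty open set $U\subseteq\mathbb{R}^d$ such that $\varphi_i(U)\subseteq U$ for all $i\in\Lambda$ and $\varphi_i(U)\cap\varphi_j(U)=\emptyset$ for all $i\ne j\in\Lambda$; such a $U$ is called an OSC set. *)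

(* Defs.v *)
From HB Require Import structures.
From mathcomp Require Import all_boot all_order all_algebra.
From mathcomp Require Import all_classical all_reals all_analysis.
Import Order.TTheory GRing.Theory Num.Theory.
Import numFieldNormedType.Exports.

Set Implicit Arguments.
Unset Strict Implicit.
Unset Printing Implicit Defensive.

Local Open Scope classical_set_scope.
Local Open Scope ring_scope.

Section Euclidean.
Context {R : realType} {d : nat}.
Implicit Types (A B F M : set 'rV[R]_d) (f : 'rV[R]_d -> 'rV[R]_d).

(* The library's norm on 'rV[R]_d is the sup norm; it induces the same
   topology as [enorm], so [open], [compact] and [lim] below are the library's,
   whereas similarities and the Hausdorff distance are defined with [enorm]. *)
Definition enorm (x : 'rV[R]_d) : R := Num.sqrt (\sum_(j < d) x ord0 j ^+ 2).

Definition unit_cube : set 'rV[R]_d :=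
  [set x | forall j, 0 <= x ord0 j <= 1].

Definition is_similarity (r : R) f : Prop :=
  0 < r /\ forall x y, enorm (f x - f y) = r * enorm (x - y).

Definition contracting_similarity f : Prop :=
  exists2 r, r < 1 & is_similarity r f.

Definition expanding_similarity f : Prop :=
  exists2 r, 1 <= r & is_similarity r f.

Definition thickening (e : R) A : set 'rV[R]_d :=
  [set x | exists2 a, A a & enorm (x - a) <= e].

(* Meaningful on non-empty compact sets only: there the set of admissible
   radii is non-empty, whereas [inf] of an empty set of reals is 0. *)
Definition hausdorff_dist A B : R :=
  inf [set e | [/\ 0 <= e, A `<=` thickening e B & B `<=` thickening e A]].

Definition nonempty_compact A : Prop := A !=set0 /\ compact A.

Definition hausdorff_cvg (A_ : nat -> set 'rV[R]_d) A : Prop :=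
  (fun n => hausdorff_dist (A_ n) A) @ \oo --> (0 : R).

(* Closure in the space of non-empty compact sets. *)
Definition hausdorff_closure (S : set (set 'rV[R]_d)) : set (set 'rV[R]_d) :=
  [set A | nonempty_compact A /\
     forall e : R, 0 < e -> exists2 B, S B & hausdorff_dist A B < e].

Definition miniset F M : Prop :=
  M !=set0 /\
  exists2 f, expanding_similarity f & M = unit_cube `&` f @` F.

Definition microset F M : Prop :=
  nonempty_compact M /\
  exists2 M_ : nat -> set 'rV[R]_d,
    forall n, miniset F (M_ n) & hausdorff_cvg M_ M.

End Euclidean.

Section Trees.
Context {L : Type}.
Implicit Types (T : set (seq L)) (v : seq L).

Definition is_tree T : Prop :=
  T [::] /\ forall v w, T (v ++ w) -> T v.

Definition leafless T : Prop :=
  forall v, T v -> exists j, T (rcons v j).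

Definition tree_boundary T : set (nat -> L) :=
  [set i | forall n, T (mkseq i n)].

Definition subtree T v : set (seq L) := [set w | T (v ++ w)].

End Trees.

Section IFS.
Context {R : realType} {d : nat} {L : finType}.
Variable phi : L -> 'rV[R]_d -> 'rV[R]_d.

Definition similarity_IFS : Prop :=
  (0 < #|L|)%N /\ forall i, contracting_similarity (phi i).

(* [word_map [:: i1; ...; in]] is [phi i1 \o ... \o phi in]. *)
Definition word_map (w : seq L) (x : 'rV[R]_d) : 'rV[R]_d := foldr phi x w.

Definition coding_map (i : nat -> L) : 'rV[R]_d :=
  lim ((fun n => word_map (mkseq i n) 0) @ \oo).

Definition tree_set (T : set (seq L)) : set 'rV[R]_d :=
  coding_map @` tree_boundary T.

Definition descendant_sets (T : set (seq L)) : set (set 'rV[R]_d) :=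
  [set tree_set (subtree T v) | v in T].

Definition OSC_set (U : set 'rV[R]_d) : Prop :=
  [/\ U !=set0, open U,
      forall i, phi i @` U `<=` U &
      forall i j, i <> j -> phi i @` U `&` phi j @` U = set0].

End IFS.

(* Main.v *)
Require Import Defs.
From mathcomp Require Import all_boot all_order all_algebra.
From mathcomp Require Import all_classical all_reals all_analysis.
From mathcomp Require Import ring lra.
Import Order.TTheory GRing.Theory Num.Theory.
Import numFieldNormedType.Exports.
Local Open Scope classical_set_scope.
Local Open Scope ring_scope.

(* Let A be the limit of Gamma(T^(v_n)), with words v_n that may be taken
   non-empty, since otherwise A = F.  The map psi o phi_(v_n)^-1 sends F to a set
   containing psi(Gamma(T^(v_n))), which is close to psi(A).  Its ratio exceeds
   1 by a definite factor, so one can still contract slightly towards the centre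
   of Q; with contraction ratios tending to 1 slowly enough, every point of
   Q /\ psi(A) is then a limit of points of the resulting minisets M_n of F.  By
   compactness a subsequence of (M_n) converges to a microset N containing
   Q /\ psi(A).  Under the OSC, F meets phi_(v_n)(U) only in
   phi_(v_n)(Gamma(T^(v_n))), so M_n contains near psi(U) no points other than
   those coming from Gamma(T^(v_n)), and N = Q /\ psi(A). *)

(** * The Euclidean norm and its agreement with the sup-norm topology *)

Section EuclideanNorm.
Set Implicit Arguments.
Unset Strict Implicit.
Context {R : realType} {d : nat}.
Implicit Types (x y z : 'rV[R]_d) (A : set 'rV[R]_d) (a r e : R).

Definition dot x y : R := \sum_(j < d) x ord0 j * y ord0 j.

Lemma dotC x y : dot x y = dot y x.
Proof. by apply: eq_bigr => j _; rewrite mulrC. Qed.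

Lemma dotDl x y z : dot (x + y) z = dot x z + dot y z.
Proof. by rewrite -big_split; apply: eq_bigr => j _; rewrite mxE mulrDl. Qed.

Lemma dotZl a x z : dot (a *: x) z = a * dot x z.
Proof. by rewrite mulr_sumr; apply: eq_bigr => j _; rewrite mxE mulrA. Qed.

Lemma dotNl x z : dot (- x) z = - dot x z.
Proof. by rewrite -scaleN1r dotZl mulN1r. Qed.

Lemma dotDr x y z : dot z (x + y) = dot z x + dot z y.
Proof. by rewrite dotC dotDl !(dotC z). Qed.

Lemma dotZr a x z : dot z (a *: x) = a * dot z x.
Proof. by rewrite dotC dotZl dotC. Qed.

Lemma dotNr x z : dot z (- x) = - dot z x.
Proof. by rewrite dotC dotNl dotC. Qed.

Lemma dotxx_ge0 x : 0 <= dot x x.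
Proof. by apply: sumr_ge0 => j _; rewrite -expr2 sqr_ge0. Qed.

Lemma enormE x : enorm x = Num.sqrt (dot x x).
Proof. by congr Num.sqrt; apply: eq_bigr => j _; rewrite expr2. Qed.

Lemma sqr_enorm x : enorm x ^+ 2 = dot x x.
Proof. by rewrite enormE sqr_sqrtr ?dotxx_ge0. Qed.

Lemma enorm_ge0 x : 0 <= enorm x.
Proof. exact: sqrtr_ge0. Qed.

Lemma enorm_ge_coord x j : `|x ord0 j| <= enorm x.
Proof.
rewrite -(ler_pXn2r (ltn0Sn 1)) ?nnegrE ?enorm_ge0 //.
rewrite sqr_enorm real_normK ?num_real// /dot (bigD1 j)//= -expr2 lerDl.
by apply: sumr_ge0 => i _; rewrite -expr2 sqr_ge0.
Qed.

Lemma enorm_eq0 x : enorm x = 0 -> x = 0.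
Proof.
move=> x0; apply/rowP => j; apply/eqP; rewrite mxE -normr_eq0 eq_le normr_ge0.
by rewrite -x0 enorm_ge_coord.
Qed.

Lemma enormZ a x : enorm (a *: x) = `|a| * enorm x.
Proof.
by rewrite !enormE dotZl dotZr mulrA -expr2 sqrtrM ?sqr_ge0// sqrtr_sqr.
Qed.

Lemma enorm0 : enorm (0 : 'rV[R]_d) = 0.
Proof. by rewrite -(scale0r 0) enormZ normr0 mul0r. Qed.

Lemma enormN x : enorm (- x) = enorm x.
Proof. by rewrite -scaleN1r enormZ normrN1 mul1r. Qed.

Lemma enormBC x y : enorm (x - y) = enorm (y - x).
Proof. by rewrite -enormN opprB. Qed.

(** Cauchy-Schwarz: expand the non-negative squared norm of |y|^2 x - <x,y> y and divide by
    |y|^2. *)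
Lemma dot_le_enorm x y : dot x y <= enorm x * enorm y.
Proof.
have [/enorm_eq0 ->|y0] := eqVneq (enorm y) 0.
  by rewrite enorm0 mulr0 -(scale0r 0) dotZr mul0r.
have [xy|xy] := leP (dot x y) 0.
  by rewrite (le_trans xy)// mulr_ge0 ?enorm_ge0.
have {}y0 : 0 < enorm y by rewrite lt_neqAle eq_sym y0 enorm_ge0.
rewrite -(ler_pXn2r (ltn0Sn 1)) ?nnegrE ?mulr_ge0 ?enorm_ge0 ?(ltW xy)//.
rewrite exprMn.
have := dotxx_ge0 (enorm y ^+ 2 *: x - dot x y *: y).
rewrite dotDl !dotDr !dotNl !dotNr !dotZl !dotZr (dotC y x) -!sqr_enorm.
have y2 : 0 < enorm y ^+ 2 by rewrite exprn_gt0.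
have -> : enorm y ^+ 2 * (enorm y ^+ 2 * enorm x ^+ 2) -
   enorm y ^+ 2 * (dot x y * dot x y) +
   (- (dot x y * (enorm y ^+ 2 * dot x y)) - - (dot x y * (dot x y * enorm y ^+ 2)))
   = enorm y ^+ 2 * (enorm x ^+ 2 * enorm y ^+ 2 - dot x y ^+ 2) by ring.
by rewrite pmulr_rge0// subr_ge0.
Qed.

Lemma enormD x y : enorm (x + y) <= enorm x + enorm y.
Proof.
rewrite -(ler_pXn2r (ltn0Sn 1)) ?nnegrE ?addr_ge0 ?enorm_ge0//.
rewrite sqr_enorm dotDl !dotDr (dotC y x) sqrrD !sqr_enorm.
have := dot_le_enorm x y; lra.
Qed.

Lemma enorm_triangle y x z : enorm (x - z) <= enorm (x - y) + enorm (y - z).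
Proof. by rewrite (le_trans _ (enormD _ _))// addrA subrK. Qed.


Lemma nbhs_enormP x A :
  nbhs x A <-> exists2 e : R, 0 < e & forall y, enorm (x - y) < e -> A y.
Proof.
split=> [/nbhs_ballP[e /= e0 xA]|[e e0 xA]].
  exists e => // y xye; apply: xA; split=> // i j.
  rewrite /ball/= (le_lt_trans _ xye)// ord1.
  by have := enorm_ge_coord (x - y) j; rewrite !mxE.
(* With d + 1 in place of the square root of d, the radius makes sense for d = 0, and d < (d + 1)^2
   gives the strict bound when d > 0. *)
have d1 : 0 < (d%:R + 1 : R) by rewrite ltr_wpDl.
apply/nbhs_ballP; exists (e / (d%:R + 1)); rewrite /= ?divr_gt0// => y [_ xy].
apply: xA; rewrite -(ltr_pXn2r (ltn0Sn 1)) ?nnegrE ?enorm_ge0 ?(ltW e0)//.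
rewrite sqr_enorm.
have [d0|d0] := eqVneq (d%:R : R) 0.
  rewrite /dot; move: d0 => /eqP; rewrite pnatr_eq0 => /eqP d0.
  rewrite big1 ?exprn_gt0// => j _.
  by have := ltn_ord j; rewrite [X in (_ < X)%N]d0.
apply: (@le_lt_trans _ _ (\sum_(j < d) (e / (d%:R + 1)) ^+ 2)).
  apply: ler_sum => j _; rewrite -expr2 -real_normK ?num_real//.
  rewrite ler_pXn2r ?nnegrE ?divr_ge0 ?(ltW e0) ?(ltW d1)//.
  by have := xy ord0 j; rewrite /ball/= !mxE => /ltW.
rewrite sumr_const card_ord -[X in X < _]mulr_natl expr_div_n mulrA.
have e2 : 0 < e ^+ 2 by rewrite exprn_gt0.
rewrite ltr_pdivrMr ?exprn_gt0// mulrC ltr_pM2l//.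
have := ler0n R d; nra.
Qed.

Lemma closed_enormP A : closed A <->
  forall x, (forall e, 0 < e -> exists2 a, A a & enorm (x - a) < e) -> A x.
Proof.
split=> [cA x xA|h x xA].
  apply: cA => B /nbhs_enormP[e e0 eB].
  by have [a Aa xa] := xA e e0; exists a; split=> //; exact: eB.
apply: h => e e0.
have [|a [Aa xa]] := xA [set y | enorm (x - y) < e]; last by exists a.
by apply/nbhs_enormP; exists e.
Qed.

Lemma compact_closed_rV A : compact A -> closed A.
Proof. by apply: compact_closed; exact: norm_hausdorff. Qed.

Lemma cvg_enormP {I : Type} (G : set_system I) {FG : Filter G}
    (u : I -> 'rV[R]_d) x :
  u @ G --> x <-> forall e, 0 < e -> \forall i \near G, enorm (x - u i) < e.
Proof.
split=> [ux e e0|ux B /nbhs_enormP[e e0 eB]].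
  by apply: (ux [set y | enorm (x - y) < e]); apply/nbhs_enormP; exists e.
by rewrite /fmap/=; have := ux e e0; apply: filterS => i; exact: eB.
Qed.

Lemma open_enormP A : open A -> forall x, A x ->
  exists2 e, 0 < e & forall y, enorm (x - y) < e -> A y.
Proof. by move=> oA x Ax; apply/nbhs_enormP; exact: open_nbhs_nbhs. Qed.

Lemma unit_cube_compact : compact (@unit_cube R d).
Proof.
have := @rV_compact R d (fun=> `[0, 1]%classic) (fun=> @segment_compact R 0 1).
congr (compact _); apply/seteqP; split=> x /= xQ j; have := xQ j;
  by rewrite ?in_itv/=.
Qed.

End EuclideanNorm.

(** * Similarities of Euclidean space and their inverses *)

Section Similarities.
Set Implicit Arguments.
Unset Strict Implicit.
Context {R : realType} {d : nat}.
Implicit Types (f g : 'rV[R]_d -> 'rV[R]_d) (r s : R).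

Lemma is_similarity_id : is_similarity (1 : R) (@id 'rV[R]_d).
Proof. by split=> // x y; rewrite mul1r. Qed.

Lemma is_similarity_comp r s f g :
  is_similarity r f -> is_similarity s g -> is_similarity (r * s) (f \o g).
Proof.
move=> [r0 fE] [s0 gE]; split=> [|x y]; first exact: mulr_gt0.
by rewrite /= fE gE mulrA.
Qed.

Lemma similarity_inj r f : is_similarity r f -> injective f.
Proof.
move=> [r0 fE] x y fxy; apply/eqP; rewrite -subr_eq0; apply/eqP/enorm_eq0.
by apply/(mulfI (lt0r_neq0 r0)); rewrite -fE fxy subrr enorm0 mulr0.
Qed.

Lemma similarity_continuous r f : is_similarity r f -> continuous f.
Proof.
move=> [r0 fE] x; apply/(@cvg_enormP _ _ _ (nbhs x) (nbhs_filter x)) => e e0.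
apply/nbhs_enormP.
by exists (e / r); rewrite ?divr_gt0// => y; rewrite ltr_pdivlMr// mulrC -fE.
Qed.

(* Normalized to fix the origin, a similarity preserves the inner product; the
   images of the standard basis are then the rows of an orthogonal matrix, and
   a one-sided inverse of a square matrix is two-sided. *)
Lemma similarity_bij r f : is_similarity r f ->
  exists g, [/\ is_similarity r^-1 g, cancel f g & cancel g f].
Proof.
move=> [r0 fE]; pose h x := r^-1 *: (f x - f 0).
have hE x y : enorm (h x - h y) = enorm (x - y).
  rewrite /h -scalerBr opprB addrA subrK enormZ fE ger0_norm ?invr_ge0 ?ltW//.
  by rewrite mulKf// lt0r_neq0.
have h0 : h 0 = 0 by rewrite /h subrr scaler0.
have hn x : enorm (h x) = enorm x by have := hE x 0; rewrite h0 !subr0.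
(* Polarization, from the preservation of norms and distances. *)
have hdot x y : dot (h x) (h y) = dot x y.
  have := congr1 (fun t => t ^+ 2) (hE x y); rewrite !sqr_enorm.
  rewrite !dotDl !dotDr !dotNl !dotNr -!sqr_enorm !hn !sqr_enorm.
  rewrite (dotC (h y)) (dotC y); lra.
pose b i : 'rV[R]_d := delta_mx ord0 i.
have dotb x i : dot x (b i) = x ord0 i.
  rewrite /dot (bigD1 i)//= mxE !eqxx mulr1 big1 ?addr0// => j ji.
  by rewrite mxE (negPf ji) mulr0.
pose O : 'M[R]_d := \matrix_(i, j) h (b i) ord0 j.
have hO x : h x *m O^T = x.
  apply/rowP => i; rewrite -[RHS]dotb -hdot !mxE; apply: eq_bigr => j _.
  by rewrite !mxE.
have OO : O *m O^T = 1%:M.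
  apply/matrixP => i j; have := hO (b i) => /rowP/(_ j).
  by rewrite !mxE eqxx/= eq_sym => <-; apply: eq_bigr => k _; rewrite !mxE.
have OO' := mulmx1C OO.
have hxO x : h x = x *m O by rewrite -[in RHS](hO x) -mulmxA OO' mulmx1.
pose g y := (r^-1 *: (y - f 0)) *m O^T.
have fg : cancel g f.
  move=> y; have : h (g y) = r^-1 *: (y - f 0).
    by rewrite hxO /g -mulmxA OO' mulmx1.
  rewrite /h => /(scalerI (invr_neq0 (lt0r_neq0 r0))).
  by move/addIr.
exists g; split=> [|x|//]; last exact: hO.
  split=> [|x y]; first by rewrite invr_gt0.
  by rewrite -[in RHS](fg x) -[in RHS](fg y) fE mulKf// lt0r_neq0.
Qed.

End Similarities.

(** * The Hausdorff distance and compactness of the space of compact sets *)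

Section HausdorffDistance.
Set Implicit Arguments.
Unset Strict Implicit.
Context {R : realType} {d : nat}.
Implicit Types (A B C M N : set 'rV[R]_d) (x y : 'rV[R]_d) (e : R).

Lemma compact_enorm_bounded A : compact A ->
  exists b, forall x, A x -> enorm x <= b.
Proof.
move=> cA.
have enorm_cont : continuous (@enorm R d).
  move=> x; apply/(@cvgrPdist_lt _ _ _ (nbhs x) (nbhs_filter x)) => e e0.
  apply/nbhs_enormP; exists e => // y; apply: le_lt_trans.
  have := enorm_triangle y x 0; have := enorm_triangle x y 0.
  by rewrite !subr0 (enormBC y x) ler_norml; lra.
have : compact ((@enorm R d : _ -> R^o) @` A).
  by apply: continuous_compact => //; exact: continuous_subspaceT.
move=> /compact_bounded[b [_ bA]]; exists (b + 1) => x Ax.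
apply: le_trans (ler_norm _) _; apply: (bA (b + 1)); first by rewrite ltrDl.
by exists x.
Qed.

Lemma hausdorff_dist_ge0 A B : 0 <= hausdorff_dist A B.
Proof.
rewrite /hausdorff_dist; set S := (X in inf X).
have [->|S0] := eqVneq S set0; first by rewrite inf0.
by apply: lb_le_inf => [|e []//]; exact/set0P.
Qed.

Lemma hausdorff_dist_le A B e : 0 <= e ->
  A `<=` thickening e B -> B `<=` thickening e A -> hausdorff_dist A B <= e.
Proof. by move=> e0 AB BA; apply: ge_inf => //; exists 0 => t []. Qed.

Lemma subset_thickening A e : 0 <= e -> A `<=` thickening e A.
Proof. by move=> e0 x Ax; exists x => //; rewrite subrr enorm0. Qed.

Lemma hausdorff_distxx A : hausdorff_dist A A = 0.
Proof.
apply/eqP; rewrite eq_le hausdorff_dist_ge0 andbT.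
by apply: hausdorff_dist_le => //; exact: subset_thickening.
Qed.

Lemma bounded_thickening A B a b : A !=set0 ->
  (forall x, A x -> enorm x <= a) -> (forall x, B x -> enorm x <= b) ->
  B `<=` thickening (a + b) A.
Proof.
move=> [x Ax] Aa Bb y By; exists x => //.
by have := Aa _ Ax; have := Bb _ By; have := enormD y (- x); rewrite enormN; lra.
Qed.

(** The infimum gives an admissible radius below [e] once some radius is admissible; the bounds on
    the two non-empty sets provide [a + b]. *)
Lemma hausdorff_dist_lt A B a b e : A !=set0 -> B !=set0 ->
  (forall x, A x -> enorm x <= a) -> (forall x, B x -> enorm x <= b) ->
  hausdorff_dist A B < e ->
  A `<=` thickening e B /\ B `<=` thickening e A.
Proof.
move=> A0 B0 Aa Bb /inf_lt[|r [r0 AB BA] re].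
  have [x Ax] := A0; have [y By] := B0; exists (a + b); split.
  - by apply: addr_ge0; [apply: le_trans (Aa _ Ax)|apply: le_trans (Bb _ By)];
      exact: enorm_ge0.
  - by rewrite addrC; exact: bounded_thickening.
  - exact: bounded_thickening.
have mono C D : C `<=` thickening r D -> C `<=` thickening e D.
  by move=> CD x /CD[y Dy xy]; exists y => //; rewrite (le_trans xy)// ltW.
by split; exact: mono.
Qed.

Lemma hausdorff_cvg_cst M : hausdorff_cvg (fun=> M) M.
Proof. by rewrite /hausdorff_cvg hausdorff_distxx; exact: cvg_cst. Qed.

(** An ultrafilter converges to each of its cluster points. *)
Lemma ultra_compact_cvg {I : Type} (G : set_system I) {GU : UltraFilter G}
    C (u : I -> 'rV[R]_d) : compact C -> (\forall i \near G, C (u i)) ->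
  exists2 y, C y & u @ G --> y.
Proof.
move=> cC Cu; have [y [Cy uy]] := cC (u @ G) _ Cu.
exists y => //; apply/cvg_enormP => e e0.
have [//|far] := in_ultra_setVsetC (fun i => enorm (y - u i) < e) GU.
have ny : nbhs y [set z | enorm (y - z) < e] by apply/nbhs_enormP; exists e.
by have [z [/= nz ze]] := uy [set z | ~ (enorm (y - z) < e)] _ far ny.
Qed.

(* Blaschke's selection theorem.  Along an ultrafilter on the indices, which
   makes every sequence in a compact set converge, the limit is the set of
   points every neighbourhood of which meets most of the sets. *)
Lemma blaschke_selection C (K : nat -> set 'rV[R]_d) :
  compact C -> (forall n, K n !=set0) -> (forall n, K n `<=` C) ->
  exists (N : set 'rV[R]_d) (s : nat -> nat),
  [/\ nonempty_compact N, hausdorff_cvg (K \o s) N, N `<=` C,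
    forall x, (forall e, 0 < e ->
       \forall n \near \oo, exists2 z, K n z & enorm (x - z) < e) -> N x &
    forall x, N x -> forall e, 0 < e -> forall n, exists2 m, (n <= m)%N &
       exists2 z, K m z & enorm (x - z) < e].
Proof.
move=> cC K0 KC.
have [G [GU sG]] := @ultraFilterLemma _ (\oo : set_system nat) _.
have GF : ProperFilter G by exact: ultra_proper.
pose N : set 'rV[R]_d := [set x | forall e, 0 < e ->
  \forall n \near G, exists2 z, K n z & enorm (x - z) < e].
have lim_in u y : (\forall n \near G, K n (u n)) -> u @ G --> y -> N y.
  move=> Ku /cvg_enormP uy e e0; move: (uy e e0) Ku.
  by apply: filterS2 => n yu Ku; exists (u n).
have clN : closed N.
  apply/closed_enormP => x xN e e0.
  have e2 : 0 < e / 2 by rewrite divr_gt0.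
  have [a Na xa] := xN _ e2; move: (Na _ e2).
  apply: filterS => n [z Kz az]; exists z => //.
  by rewrite (le_lt_trans (enorm_triangle a _ _))// (splitr e) ltrD.
have NC : N `<=` C.
  move=> x Nx; move/closed_enormP: (compact_closed_rV cC); apply => e e0.
  by have [n [z Kz xz]] := filter_ex (Nx _ e0); exists z => //; exact: KC Kz.
have cN : compact N by exact: (subclosed_compact clN cC).
have limK (u : nat -> 'rV[R]_d) :
    (\forall n \near G, K n (u n)) -> exists2 y, N y & u @ G --> y.
  move=> Ku; have [|y Cy uy] := @ultra_compact_cvg _ G GU C u cC.
    by move: Ku; apply: filterS => n; exact: KC.
  by exists y => //; exact: (lim_in u).
(* Otherwise points of [K n] outside the thickening, chosen for most [n], would converge along [G]
   to a point of [N]. *)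
have subN e : 0 < e -> \forall n \near G, K n `<=` thickening e N.
  move=> e0.
  have [//|out] := in_ultra_setVsetC (fun n => K n `<=` thickening e N) GU.
  have /choice[u uP] (n : nat) : exists z, K n z /\
      (~ (K n `<=` thickening e N) -> ~ thickening e N z).
    have [KN|/existsNP[z /not_implyP[Kz nz]]] :=
      pselect (K n `<=` thickening e N); last by exists z.
    by have [z Kz] := K0 n; exists z.
  have [|y Ny /cvg_enormP/(_ e e0) uy] := limK u.
    by apply: filterE => n; have [] := uP n.
  have [n [/= nN yu]] := filter_ex (filterI out uy).
  have [_ /(_ nN)] := uP n; case; exists y => //.
  by rewrite enormBC ltW.
(* Otherwise points of [N] far from [K n] would converge along [G] to some [y] in [N], near which
   most [K n] have points. *)
have Nsub e : 0 < e -> \forall n \near G, N `<=` thickening e (K n).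
  move=> e0.
  have [//|out] := in_ultra_setVsetC (fun n => N `<=` thickening e (K n)) GU.
  have [k0 [z0 Kz0]] : exists k z, K k z by exists 0%N; exact: K0.
  have [y0 Ny0] : N !=set0.
    have /choice[u uP] : forall n, exists z, K n z by [].
    by have [|y Ny _] := limK u; [exact: filterE|exists y].
  have /choice[u uP] (n : nat) : exists z, N z /\
      (~ (N `<=` thickening e (K n)) -> ~ thickening e (K n) z).
    have [KN|/existsNP[z /not_implyP[Kz nz]]] :=
      pselect (N `<=` thickening e (K n)); last by exists z.
    by exists y0.
  have e2 : 0 < e / 2 by rewrite divr_gt0.
  have [|y Ny /cvg_enormP/(_ _ e2) uy] := ultra_compact_cvg cN (u := u) (G := G).
    by apply: filterE => n; have [] := uP n.
  have [n [[/= nN yu] [z Kz yz]]] := filter_ex (filterI (filterI out uy) (Ny _ e2)).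
  have [_ /(_ nN)] := uP n; case; exists z => //.
  rewrite (le_trans (enorm_triangle y _ _))// (splitr e) lerD// ltW//.
  by rewrite enormBC.
have NK e n : 0 < e -> exists2 m, (n <= m)%N & hausdorff_dist (K m) N <= e.
  move=> e0.
  have Gn : \forall m \near G, (n <= m)%N by apply: sG; exact: nbhs_infty_ge.
  have [m [[/= nm KN] NK]] := filter_ex (filterI (filterI Gn (subN _ e0)) (Nsub _ e0)).
  by exists m => //; apply: hausdorff_dist_le => //; exact: ltW.
have /choice[s sP] (n : nat) : exists m, hausdorff_dist (K m) N <= n.+1%:R^-1.
  by have [|m _ ?] := @NK n.+1%:R^-1 n; [rewrite invr_gt0|exists m].
exists N, s; split=> //.
- split=> //; have /choice[u uP] : forall n, exists z, K n z by [].
  by have [|y Ny _] := limK u; [exact: filterE|exists y].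
- apply/cvgrPdist_lt => e e0; near=> n.
  rewrite sub0r normrN ger0_norm ?hausdorff_dist_ge0//.
  by rewrite (le_lt_trans (sP n))//; near: n; exact: near_infty_natSinv_lt (PosNum e0).
(* The last two clauses concern [K] itself: what holds for all large indices holds along [G], and
   what holds along [G] holds at arbitrarily large indices. *)
- by move=> x xK e e0; apply: sG; exact: xK.
- move=> x Nx e e0 n.
  have Gn : \forall m \near G, (n <= m)%N by apply: sG; exact: nbhs_infty_ge.
  by have [m [/= nm Km]] := filter_ex (filterI Gn (Nx _ e0)); exists m.
Unshelve. all: by end_near. Qed.

End HausdorffDistance.

(** * Infinite branches of trees, and cutting and gluing them *)

Section Branches.
Set Implicit Arguments.
Unset Strict Implicit.
Context {L : Type}.
Implicit Types (T : set (seq L)) (v w : seq L) (i : nat -> L).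

Lemma mkseq_addn i m n :
  mkseq i (m + n) = mkseq i m ++ mkseq (fun k => i (m + k)%N) n.
Proof.
by rewrite /mkseq iotaD map_cat add0n -[in iota m n](addn0 m) iotaDl -map_comp.
Qed.

Definition prepend v i : nat -> L :=
  fun k => if (k < size v)%N then nth (i 0%N) v k else i (k - size v)%N.

Lemma mkseq_prepend v i n : mkseq (prepend v i) (size v + n) = v ++ mkseq i n.
Proof.
rewrite mkseq_addn; congr (_ ++ _).
  apply: (@eq_from_nth _ (i 0%N)); rewrite size_mkseq// => k kv.
  by rewrite nth_mkseq// /prepend kv.
by apply: eq_mkseq => k; rewrite /prepend ltnNge leq_addr/= addKn.
Qed.

Lemma prepend_mkseq i n : prepend (mkseq i n) (fun k => i (n + k)%N) = i.
Proof.
apply/funext => k; rewrite /prepend size_mkseq.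
by case: ltnP => kn; [rewrite nth_mkseq|rewrite subnKC].
Qed.

Lemma boundary_prepend T v i : is_tree T ->
  tree_boundary (subtree T v) i -> tree_boundary T (prepend v i).
Proof.
(* A prefix of length [n] may be shorter than [v]; it is lengthened by [size v] so as to begin with
   [v], and [T] is closed under prefixes. *)
move=> [_ Tpre] Ti n; apply: (Tpre _ (mkseq (fun k => prepend v i (n + k)%N) (size v))).
by rewrite -mkseq_addn addnC mkseq_prepend; exact: Ti.
Qed.

Lemma boundary_shift T i n : tree_boundary T i ->
  tree_boundary (subtree T (mkseq i n)) (fun k => i (n + k)%N).
Proof. by move=> Ti k; rewrite /subtree/= -mkseq_addn; exact: Ti. Qed.

Lemma subtree_leafless T v : leafless T -> leafless (subtree T v).
Proof.
by move=> lT w /lT[j Tj]; exists j; rewrite /subtree/= -rcons_cat.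
Qed.

Lemma leafless_boundary T : T [::] -> leafless T -> tree_boundary T !=set0.
Proof.
move=> T0 lT; have [j0 _] := lT _ T0.
(* The choice must be total, so [j0] serves for words outside [T]. *)
have /choice[next nextP] v : exists j, T v -> T (rcons v j).
  by have [/lT[j Tj]|nTv] := pselect (T v); [exists j|exists j0].
pose w := fix w n := if n is m.+1 then rcons (w m) (next (w m)) else [::].
exists (fun n => next (w n)) => n.
have -> : mkseq (fun n => next (w n)) n = w n.
  by elim: n => // n IHn; rewrite mkseqS IHn.
by elim: n => //= n; exact: nextP.
Qed.

End Branches.

(** * The coding map, its self-similarity, and the open set condition *)

Section IteratedFunctionSystem.
Set Implicit Arguments.
Unset Strict Implicit.
Context {R : realType} {d : nat} {L : finType}.
Context {phi : L -> 'rV[R]_d -> 'rV[R]_d} {rho : R}.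
Context (rho_gt0 : 0 < rho) (rho_lt1 : rho < 1).
Context (phi_sim : forall i, exists2 r, r <= rho & is_similarity r (phi i)).
Implicit Types (x y : 'rV[R]_d) (v w : seq L) (i : nat -> L) (T : set (seq L)).
Implicit Types (U : set 'rV[R]_d).

Lemma word_map_cat v w x : word_map phi (v ++ w) x = word_map phi v (word_map phi w x).
Proof. exact: foldr_cat. Qed.

Lemma word_map_similarity w :
  exists2 r, r <= rho ^+ size w & is_similarity r (word_map phi w).
Proof.
elim: w => [|j w [r rw wE]]; first by exists 1 => //; exact: is_similarity_id.
have [s sr jE] := phi_sim j; exists (s * r); last exact: is_similarity_comp.
by rewrite exprS ler_pM//; [case: jE => /ltW|case: wE => /ltW].
Qed.

Lemma word_map_contract w x y :
  enorm (word_map phi w x - word_map phi w y) <= rho ^+ size w * enorm (x - y).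
Proof.
by have [r rw [_ ->]] := word_map_similarity w; rewrite ler_wpM2r ?enorm_ge0.
Qed.

Lemma invariant_ball : exists b : R, forall c, b <= c ->
  forall w x, enorm x <= c -> enorm (word_map phi w x) <= c.
Proof.
(* For [c] at least this large, |phi_j(y)| <= |phi_j(0)| + rho c <= (1 - rho) c + rho c whenever |y|
   <= c. *)
exists ((\sum_j enorm (phi j 0)) / (1 - rho)) => c bc w x xc.
elim: w => //= j w; set y := word_map phi w x => yc.
have := enorm_triangle (phi j 0) (phi j y) 0; rewrite !subr0.
have [r rrho [r0 ->]] := phi_sim j; rewrite subr0 => /le_trans; apply.
have jb : enorm (phi j 0) <= \sum_j enorm (phi j 0).
  by rewrite [leRHS](bigD1 j)//= lerDl sumr_ge0// => k _; exact: enorm_ge0.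
have {}bc : \sum_j enorm (phi j 0) <= c * (1 - rho).
  by rewrite -ler_pdivrMr ?subr_gt0.
have := ler_pM (ltW r0) (enorm_ge0 y) rrho yc; lra.
Qed.

Lemma geometric_lt (c e : R) : 0 < e -> exists m, rho ^+ m * c < e.
Proof.
move=> e0.
have rho_cvg : (fun m => rho ^+ m * c) @ \oo --> (0 : R).
  rewrite -(mul0r c); apply: cvgM (cvg_cst _); apply: cvg_expr.
  by rewrite ger0_norm ?ltW.
have /cvgrPdist_lt/(_ e e0) := rho_cvg.
move=> /filter_ex[m]; rewrite sub0r normrN => /(le_lt_trans (ler_norm _)) ?.
by exists m.
Qed.

(** Later approximations apply the first [m] maps to points of a fixed ball, hence differ by a
    multiple of rho^m; this gives convergence and the rate. The case [m = 0], [x = 0] bounds all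
    coded points. *)
Lemma coding_map_dist : exists b : R, forall i x m,
  enorm (word_map phi (mkseq i m) x - coding_map phi i)
    <= rho ^+ m * (b + enorm x).
Proof.
have [b bP] := invariant_ball; pose c := `|b|.
have bc : b <= c by exact: ler_norm.
have c0 : 0 <= c by exact: normr_ge0.
have zc w : enorm (word_map phi w 0) <= c by apply: bP; rewrite ?enorm0.
have step i x m k : enorm (word_map phi (mkseq i m) x -
    word_map phi (mkseq i (m + k)) 0) <= rho ^+ m * (c + enorm x).
  rewrite mkseq_addn word_map_cat (le_trans (word_map_contract _ _ _))//.
  rewrite size_mkseq ler_pM2l ?exprn_gt0//.
  have := enormD x (- word_map phi (mkseq (fun j => i (m + j)%N) k) 0).
  by rewrite enormN; have := zc (mkseq (fun j => i (m + j)%N) k); lra.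
have cvgi i : (fun n => word_map phi (mkseq i n) 0) @ \oo --> coding_map phi i.
  apply/cauchy_cvgP/cauchy_exP => e e0.
  have [m me] := geometric_lt (c + enorm (0 : 'rV[R]_d)) e0.
  exists (word_map phi (mkseq i m) 0); exists m => // n /= /subnKC <-.
  split=> // i0 j; rewrite ord1 /ball/= (le_lt_trans _ me)//.
  rewrite (le_trans _ (step i 0 m (n - m)%N))//.
  by rewrite (le_trans _ (enorm_ge_coord _ j))// !mxE.
exists c => i x m; apply/ler_addgt0Pr => e e0.
have /cvg_enormP/(_ e e0) near_i := cvgi i.
have [k [/= /subnKC <- ke]] := filter_ex (filterI (nbhs_infty_ge m) near_i).
have := step i x m (k - m)%N; move: ke; rewrite enormBC => ke sk.
pose y := word_map phi (mkseq i (m + (k - m))) 0.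
by rewrite (le_trans (enorm_triangle y _ _))// lerD// ltW.
Qed.

Lemma coding_map_eq i x (u : nat -> 'rV[R]_d) (c : R) :
  (forall m, enorm (u m - coding_map phi i) <= rho ^+ m * c) ->
  (forall m, enorm (u m - x) <= rho ^+ m * c) -> x = coding_map phi i.
Proof.
move=> ui ux; apply/eqP; rewrite -subr_eq0; apply/eqP/enorm_eq0/eqP.
rewrite eq_le enorm_ge0 andbT; apply/ler_addgt0Pr => e e0.
have [m me] := geometric_lt (c + c) e0.
have := ui m; have := ux m; have := enorm_triangle (u m) x (coding_map phi i).
by rewrite (enormBC x (u m)); move: me; rewrite mulrDr; lra.
Qed.

Lemma word_map_coding v i :
  word_map phi v (coding_map phi i) = coding_map phi (prepend v i).
Proof.
have [b bP] := coding_map_dist.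
(* Both sides are limits of [u] at a geometric rate: [u m] approximates the code [prepend v i] and
   is also the image under [word_map phi v] of an approximation to the code [i]. *)
pose u m := word_map phi (v ++ mkseq i m) 0.
have rv1 : rho ^+ size v <= 1 by rewrite exprn_ile1 ?ltW.
have rm0 m : 0 <= rho ^+ m * (b + enorm (0 : 'rV[R]_d)).
  by rewrite (le_trans (enorm_ge0 _) (bP i 0 m)).
apply: (@coding_map_eq _ _ u (b + enorm (0 : 'rV[R]_d))) => m.
  rewrite /u -mkseq_prepend (le_trans (bP _ _ _))// exprD -mulrA.
  by rewrite ler_piMl.
rewrite /u word_map_cat (le_trans (word_map_contract _ _ _))//.
by rewrite (le_trans _ (bP i 0 m))// ler_piMl ?enorm_ge0.
Qed.

Lemma tree_set_bounded : exists b : R, forall T x, tree_set phi T x -> enorm x <= b.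
Proof.
have [b bP] := coding_map_dist; exists b => T _ [i _ <-].
by have := bP i 0 0%N; rewrite sub0r enormN enorm0 addr0 expr0 mul1r.
Qed.

Lemma word_map_tree_set T v x : is_tree T ->
  tree_set phi (subtree T v) x -> tree_set phi T (word_map phi v x).
Proof.
move=> tT [i Ti <-]; exists (prepend v i); first exact: boundary_prepend.
by rewrite word_map_coding.
Qed.

Lemma tree_set_split T n x : tree_set phi T x -> exists w y,
  [/\ size w = n, tree_set phi (subtree T w) y & x = word_map phi w y].
Proof.
move=> [i Ti <-].
exists (mkseq i n), (coding_map phi (fun k => i (n + k)%N)).
split; first by rewrite size_mkseq.
  by eexists; [exact: boundary_shift|].
by rewrite word_map_coding prepend_mkseq.
Qed.

Lemma OSC_word_map U w x : OSC_set phi U -> U x -> U (word_map phi w x).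
Proof.
by move=> [_ _ inU _] Ux; elim: w => //= j w Uw; apply: (inU j);
  exists (word_map phi w x).
Qed.

(** Equal first letters cancel by injectivity; at the first difference the two points lie in
    disjoint images of [U]. *)
Lemma OSC_word_map_inj U v w x y : OSC_set phi U -> size v = size w ->
  U x -> U y -> word_map phi v x = word_map phi w y -> v = w.
Proof.
move=> oU + Ux Uy; elim: v w => [|j v IHv] [|k w]//= [vw] eq_vw.
have [jk|jk] := eqVneq j k.
  rewrite -{}jk in eq_vw *; have [r _ jE] := phi_sim j.
  by congr (_ :: _); apply: IHv => //; exact: (similarity_inj jE) eq_vw.
have [_ _ _ /(_ j k)] := oU; move=> /(_ (elimN eqP jk)) disj.
have : set0 (phi j (word_map phi v x)).
  rewrite -disj; split; first by exists (word_map phi v x) => //; exact: OSC_word_map.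
  by rewrite eq_vw; exists (word_map phi w y) => //; exact: OSC_word_map.
by [].
Qed.

(** The images of one point of [U] under the prefixes of [i] stay in [U] and converge to the coded
    point. *)
Lemma coding_map_OSC_closure U i e : OSC_set phi U -> 0 < e ->
  exists2 u, U u & enorm (coding_map phi i - u) < e.
Proof.
move=> oU e0; have [b bP] := coding_map_dist; have [[u Uu] _ _ _] := oU.
have [m me] := geometric_lt (b + enorm u) e0.
exists (word_map phi (mkseq i m) u); first exact: OSC_word_map.
by rewrite enormBC (le_lt_trans (bP i u m)).
Qed.

(* [word_map v @` U] is open and disjoint from [word_map w @` U], hence from
   its closure, which contains the coded points beginning with [w]. *)
Lemma OSC_word_map_coding U v w x i : OSC_set phi U -> size v = size w ->
  U x -> word_map phi v x = word_map phi w (coding_map phi i) -> v = w.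
Proof.
move=> oU vw Ux eq_vw; have [_ openU _ _] := oU.
have [e e0 xeU] := open_enormP openU Ux.
have [r _ vE] := word_map_similarity v; have [s _ wE] := word_map_similarity w.
have [g [[r0 gE] vg gv]] := similarity_bij vE.
have [s0 wd] := wE.
(* The map [g \o word_map phi w] has ratio [r^-1 * s] and sends the coded point to [x], so it sends
   [u] within [e] of [x], hence into [U]. *)
have [|u Uu ui] := @coding_map_OSC_closure U i (e / (r^-1 * s)) oU.
  by rewrite divr_gt0// mulr_gt0.
apply: (@OSC_word_map_inj U v w (g (word_map phi w u)) u) => //.
by apply: xeU; rewrite -(vg x) eq_vw gE wd mulrA mulrC -ltr_pdivlMr// mulr_gt0.
Qed.

End IteratedFunctionSystem.

(** * Minisets, and slight contractions towards the centre of the cube *)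

Section Minisets.
Set Implicit Arguments.
Unset Strict Implicit.
Context {R : realType} {d : nat}.
Implicit Types (F M : set 'rV[R]_d) (x y : 'rV[R]_d) (h : R).

Lemma miniset_compact F M : compact F -> miniset F M -> compact M.
Proof.
move=> cF [_ [f [r _ fE] ->]].
have cfF : compact (f @` F).
  apply: continuous_compact => //; apply: continuous_subspaceT.
  exact: similarity_continuous fE.
apply: (subclosed_compact _ cfF) => //; apply: closedI; apply: compact_closed_rV => //.
exact: unit_cube_compact.
Qed.

Lemma miniset_microset F M : compact F -> miniset F M -> microset F M.
Proof.
move=> cF mM; split; first by split; [case: mM|exact: miniset_compact mM].
by exists (fun=> M) => //; exact: hausdorff_cvg_cst.
Qed.

Definition cube_center : 'rV[R]_d := const_mx 2^-1.

(** The ratio is chosen to map the concentric cube of side 1 + h, which is Q enlarged by h/2 on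
    every side, onto Q. *)
Definition shrink h x : 'rV[R]_d :=
  cube_center + (1 + h)^-1 *: (x - cube_center).

Lemma shrink_similarity h : 0 <= h -> is_similarity (1 + h)^-1 (shrink h).
Proof.
move=> h0; have h1 : 0 < (1 + h)^-1 by rewrite invr_gt0 ltr_wpDr.
split=> // x y; rewrite /shrink opprD addrACA subrr add0r -scalerBr.
by rewrite opprB addrA subrK enormZ gtr0_norm.
Qed.

Lemma shrink_unit_cube h x y : unit_cube x -> enorm (x - y) <= h / 2 ->
  unit_cube (shrink h y).
Proof.
move=> xQ xy j.
have := le_trans (enorm_ge_coord (x - y) j) xy.
have h1 : 0 < 1 + h by have := le_trans (enorm_ge0 _) xy; lra.
rewrite !mxE ler_norml => xyj; have := xQ j => xj.
suff : - 2^-1 <= (1 + h)^-1 * (y ord0 j - 2^-1) <= 2^-1 by lra.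
by rewrite ler_pdivlMl// ler_pdivrMl//; lra.
Qed.

(** The displacement is expressed through the image, since it is the image that will be known to lie
    in the cube. *)
Lemma enorm_sub_shrink h x : 0 <= h ->
  enorm (shrink h x - x) = h * enorm (shrink h x - cube_center).
Proof.
move=> h0; have h1 : 1 + h != 0 by rewrite lt0r_neq0// ltr_wpDr.
have -> : shrink h x - x = - (h *: (shrink h x - cube_center)).
  by apply/rowP => j; rewrite !mxE; field.
by rewrite enormN enormZ ger0_norm.
Qed.

End Minisets.

(** * Microsets of F obtained from minisets of limits of its descendants *)

Section Microsets.
Set Implicit Arguments.
Unset Strict Implicit.
Context {R : realType} {d : nat} {L : finType}.
Context {phi : L -> 'rV[R]_d -> 'rV[R]_d}.
Implicit Types (A F M U : set 'rV[R]_d) (T : set (seq L)).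

Lemma similarity_IFS_ratio : similarity_IFS phi -> exists rho : R,
  [/\ 0 < rho, rho < 1 & forall i, exists2 r, r <= rho & is_similarity r (phi i)].
Proof.
move=> [_ sim].
have /choice[r rP] i : exists r, r < 1 /\ is_similarity r (phi i).
  by have [r r1 rE] := sim i; exists r.
(* The base value 1/2 keeps the maximum positive and is itself below 1. *)
exists (\big[Order.max/2^-1]_i r i); split.
- by rewrite (lt_le_trans _ (bigmax_ge_id _ _ _ _))// invr_gt0.
- apply: bigmax_lt => [|i _]; first by rewrite invf_lt1// ltr1n.
  by have [] := rP i.
- by move=> i; exists (r i); [exact: le_bigmax|have [] := rP i].
Qed.

Lemma cvg_nat_inv_lt (c e : R) : 0 <= c -> 0 < e ->
  \forall n \near \oo, n.+1%:R^-1 * c < e.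
Proof.
move=> c0 e0; have c1 : 0 < c + 1 by rewrite ltr_wpDl.
near=> n; have : n.+1%:R^-1 < e / (c + 1).
  by near: n; exact: near_infty_natSinv_lt (PosNum (divr_gt0 e0 c1)).
rewrite ltr_pdivlMr//; apply: le_lt_trans.
by rewrite ler_pM2l ?invr_gt0// lerDl.
Unshelve. all: by end_near. Qed.

(* The word [v] may be empty arbitrarily close to [A] only if [A = F]; a
   non-empty one makes [psi \o (word_map phi v)^-1] expand by a definite factor,
   which leaves room for composing it with [shrink h] for small [h].  This in
   turn keeps points near the boundary of the cube inside it. *)
Lemma approximating_microset F T A M (psi : 'rV[R]_d -> 'rV[R]_d) :
  similarity_IFS phi -> is_tree T -> leafless T -> F = tree_set phi T ->
  nonempty_compact A ->
  (forall e : R, 0 < e -> exists2 v, T v /\ v <> [::] &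
     hausdorff_dist A (tree_set phi (subtree T v)) < e) ->
  expanding_similarity psi -> M !=set0 -> M = unit_cube `&` psi @` A ->
  exists N, [/\ microset F N, M `<=` N & forall U, OSC_set phi U ->
    psi @^-1` unit_cube `<=` U -> N `<=` M].
Proof.
move=> /similarity_IFS_ratio[rho [rho0 rho1 phi_sim]] tT lT FE [A0 cA] Av.
move=> [r r1 psiE] M0 ME.
have r0 : 0 < r by rewrite (lt_le_trans _ r1).
(* Since rho (1 + h0) = 1, a map of ratio at least 1/rho remains expanding after [shrink (h n)], as
   h n <= h0. *)
pose h0 := rho^-1 - 1; pose h n := n.+1%:R^-1 * h0.
have h0_gt0 : 0 < h0 by rewrite subr_gt0 invf_gt1.
have h_gt0 n : 0 < h n by rewrite mulr_gt0 ?invr_gt0.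
have h_ge0 n := ltW (h_gt0 n).
have h_le n : h n <= h0 by rewrite ler_piMl ?(ltW h0_gt0)// invf_le1// ler1n.
have [a_bd Abd] := compact_enorm_bounded cA.
have [t_bd Tbd] := tree_set_bounded rho0 rho1 phi_sim.
have [q_bd Qbd] := compact_enorm_bounded (@unit_cube_compact R d).
pose D := `|q_bd| + enorm (@cube_center R d).
have D0 : 0 <= D by rewrite addr_ge0 ?enorm_ge0.
have QD z : unit_cube z -> enorm (z - @cube_center R d) <= D.
  move=> /Qbd zq; rewrite (le_trans (enormD _ _))// enormN lerD2r.
  exact: le_trans (ler_norm _).
(* The tolerance becomes h/2 under [psi], which is what [shrink] can absorb. *)
have /choice[v vP] n : exists v, [/\ T v, v <> [::] &
    A `<=` thickening (h n / (2 * r)) (tree_set phi (subtree T v)) /\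
    tree_set phi (subtree T v) `<=` thickening (h n / (2 * r)) A].
  have [|v [Tv v0] vA] := Av (h n / (2 * r)).
    by rewrite divr_gt0// mulr_gt0.
  exists v; split=> //; apply: hausdorff_dist_lt Abd (Tbd _) vA => //.
  have [||i Ti] := @leafless_boundary _ (subtree T v);
    last by exists (coding_map phi i), i.
  - by rewrite /subtree/= cats0.
  - exact: subtree_leafless.
have /choice[g gP] n : exists g, [/\ exists2 s, 0 < s <= rho & is_similarity s^-1 g,
    cancel (word_map phi (v n)) g & cancel g (word_map phi (v n))].
  have [s srho sE] := word_map_similarity phi_sim (v n).
  have [g [gE vg gv]] := similarity_bij sE; exists g; split=> //.
  exists s => //; apply/andP; split; first by case: sE.
  have [_ + _] := vP n; case: (v n) srho => //= j w srho _.
  by rewrite (le_trans srho)// exprS ler_piMr ?(ltW rho0)// exprn_ile1 ?ltW.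
pose K n := unit_cube `&` (shrink (h n) \o psi \o g n) @` F.
(* The term h/2 comes from replacing [A] by a descendant, and h D from shrinking, [D] bounding
   distances from the centre within the cube. *)
have near_K x n : M x -> exists2 z, K n z & enorm (x - z) <= h n * (2^-1 + D).
  rewrite ME => -[xQ [a Aa ax]].
  have [_ _ [/(_ a Aa)[b Tb ab] _]] := vP n; have [_ vg _] := gP n.
  have xb : enorm (x - psi b) <= h n / 2.
    have [_ psid] := psiE; rewrite -ax psid.
    have := ler_wpM2l (ltW r0) ab.
    suff -> : r * (h n / (2 * r)) = h n / 2 by [].
    by field; exact: lt0r_neq0.
  have zQ := shrink_unit_cube xQ xb.
  exists (shrink (h n) (psi b)).
    split=> //; exists (word_map phi (v n) b) => /=; last by rewrite vg.
    by rewrite FE; exact: (word_map_tree_set rho0 rho1 phi_sim).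
  rewrite (le_trans (enorm_triangle (psi b) _ _))// mulrDr lerD//.
  by rewrite enormBC enorm_sub_shrink// ler_wpM2l// QD.
(* Here [word_map phi (v n) u] is a point of [F], so it is also coded by a word of length
   [size (v n)]. If [u] is in [U], that word is [v n], which puts [u] in the descendant and thus
   near [A]. *)
have from_K n z : K n z -> exists2 u, enorm (z - psi u) <= h n * (2^-1 + D) &
    forall U, OSC_set phi U -> U u ->
    exists2 a, A a & enorm (u - a) <= h n / (2 * r).
  move=> [zQ [f Ff /= fz]]; exists (g n f).
    rewrite -fz enorm_sub_shrink// ler_wpM2l// fz.
    by rewrite (le_trans (QD _ zQ))// lerDr invr_ge0.
  move=> U oU Uu; have [_ vg gv] := gP n; have [_ _ [_ TA]] := vP n.
  apply: TA; rewrite FE in Ff.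
  have [w [y [sw Tw fy]]] := tree_set_split rho0 rho1 phi_sim (size (v n)) Ff.
  have [i _ iy] := Tw.
  suff vw : v n = w by rewrite fy -vw vg vw.
  apply: (OSC_word_map_coding rho0 rho1 phi_sim oU (esym sw) Uu (i := i)).
  by rewrite gv iy.
have K0 n : K n !=set0.
  by have [x Mx] := M0; have [z Kz _] := near_K x n Mx; exists z.
have hD e : 0 < e -> \forall n \near \oo, h n * (2^-1 + D) < e.
  move=> e0; have : 0 <= h0 * (2^-1 + D).
    by rewrite mulr_ge0 ?(ltW h0_gt0)// addr_ge0 ?invr_ge0.
  move=> /cvg_nat_inv_lt/(_ e0); apply: filterS => n.
  by rewrite mulrA.
have [N [s [cN Ncvg NQ MN NM]]] := blaschke_selection (@unit_cube_compact R d)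
  K0 (fun n => @subIsetl _ _ _).
exists N; split.
- split=> //; exists (K \o s) => // n; split; first exact: K0.
  exists (shrink (h (s n)) \o psi \o g (s n)) => //.
  have [[t /andP[t0 trho] gE] _ _] := gP (s n).
  exists ((1 + h (s n))^-1 * r * t^-1); last first.
    apply: is_similarity_comp => //; apply: is_similarity_comp => //.
    exact: shrink_similarity.
  have h1 : 0 < 1 + h (s n) by rewrite ltr_wpDr.
  (* It remains to see that t (1 + h) <= rho (1 + h0) = 1 <= r. *)
  rewrite ler_pdivlMr// mul1r mulrC ler_pdivlMr//.
  apply: le_trans r1.
  have rho_h0 : rho * (1 + h0) = 1 by rewrite /h0; field; exact: lt0r_neq0.
  by rewrite -[leRHS]rho_h0 ler_pM ?(ltW t0) ?(ltW h1)// lerD2l.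
- move=> x Mx; apply: MN => e e0; move: (hD e e0); apply: filterS => n.
  by have [z Kz xz] := near_K x n Mx; exists z => //; exact: le_lt_trans xz _.
- move=> U oU QU y Ny.
  have [g' [[_ g'E] psig' g'psi]] := similarity_bij psiE.
  have Uy : U (g' y) by apply: QU; rewrite /= g'psi; exact: NQ.
  have [_ openU _ _] := oU; have [eta eta0 etaU] := open_enormP openU Uy.
  rewrite ME; split; first exact: NQ.
  exists (g' y); last exact: g'psi.
  move/closed_enormP: (compact_closed_rV cA); apply => e e0.
  (* The point [u] will be within 2k < eta of [g' y], hence in [U], and then within k of [A], for a
     total below 3k < e. *)
  pose k := Num.min e eta / 4.
  have k0 : 0 < k by rewrite divr_gt0// lt_min e0.
  have [ke kn] : 4 * k <= e /\ 4 * k <= eta.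
    by rewrite /k mulrC divfK// !ge_min !lexx orbT.
  have [n _ hk] := hD (r * k) (mulr_gt0 r0 k0).
  have [m nm [z Kz yz]] := NM y Ny (r * k) (mulr_gt0 r0 k0) n.
  have [u zu uA] := from_K m z Kz; have {}hk := hk m nm.
  have yu : enorm (g' y - u) < 2 * k.
    rewrite -(psig' u) g'E ltr_pdivrMl//.
    rewrite (le_lt_trans (enorm_triangle z _ _))//.
    by have := le_lt_trans zu hk; lra.
  have [a Aa ua] : exists2 a, A a & enorm (u - a) <= h m / (2 * r).
    by apply: (uA U oU); apply: etaU; lra.
  exists a => //; rewrite (le_lt_trans (enorm_triangle u _ _))//.
  have : h m / (2 * r) < k.
    rewrite invfM mulrA ltr_pdivrMr// mulrC [k * r]mulrC.
    apply: le_lt_trans hk; rewrite mulrC ler_wpM2l// lerDl.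
    exact: D0.
  lra.
Qed.

(** If below some [e0] no non-empty word approximates [A], all finer approximations use the empty
    word, that is, [F]; two closed sets arbitrarily close to each other are equal. *)
Lemma hausdorff_closure_cases F T A : similarity_IFS phi -> is_tree T ->
  F !=set0 -> compact F -> F = tree_set phi T ->
  hausdorff_closure (descendant_sets phi T) A ->
  A = F \/ forall e : R, 0 < e -> exists2 v, T v /\ v <> [::] &
     hausdorff_dist A (tree_set phi (subtree T v)) < e.
Proof.
move=> sim tT F0 cF FE [[A0 cA] clA].
have [?|/existsNP[e0 /not_implyP[e00 nv]]] := pselect (forall e : R, 0 < e ->
  exists2 v, T v /\ v <> [::] & hausdorff_dist A (tree_set phi (subtree T v)) < e).
  by right.
left; have [a_bd Abd] := compact_enorm_bounded cA.
have [f_bd Fbd] := compact_enorm_bounded cF.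
have AF (e : R) : 0 < e -> A `<=` thickening e F /\ F `<=` thickening e A.
  move=> e1; have : 0 < Num.min e e0 by rewrite lt_min e1.
  move=> /clA[_ [v Tv <-]]; rewrite lt_min => /andP[ve ve0].
  apply: hausdorff_dist_lt Abd Fbd _ => //.
  suff v0 : v = [::] by move: ve; rewrite v0 -FE.
  by apply: contrapT => v0; apply: nv; exists v.
have half (e : R) : 0 < e -> 0 < e / 2 /\ e / 2 < e by move=> ?; split; lra.
apply/seteqP; split=> x.
  move=> Ax; move/closed_enormP: (compact_closed_rV cF); apply => e /half[e1 e2].
  have [/(_ x Ax)[y Fy xy] _] := AF _ e1.
  by exists y => //; exact: le_lt_trans e2.
move=> Fx; move/closed_enormP: (compact_closed_rV cA); apply => e /half[e1 e2].
have [_ /(_ x Fx)[y Ay xy]] := AF _ e1.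
by exists y => //; exact: le_lt_trans e2.
Qed.

End Microsets.

Theorem theorem1p4 (R : realType) (d : nat) (F : set 'rV[R]_d) (L : finType)
    (phi : L -> 'rV[R]_d -> 'rV[R]_d) (T : set (seq L))
    (F0 : F !=set0) (cF : compact F) (IFSphi : similarity_IFS phi)
    (treeT : is_tree T) (leaflessT : leafless T) (FE : F = tree_set phi T) :
  (forall A M : set 'rV[R]_d,
     hausdorff_closure (descendant_sets phi T) A -> miniset A M ->
     exists2 N, microset F N & M `<=` N) /\
  (forall (A M U : set 'rV[R]_d) (psi : 'rV[R]_d -> 'rV[R]_d),
     hausdorff_closure (descendant_sets phi T) A ->
     expanding_similarity psi ->
     M !=set0 -> M = unit_cube `&` psi @` A ->
     OSC_set phi U -> psi @^-1` unit_cube `<=` U ->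
     microset F M).
Proof.
have cases := hausdorff_closure_cases IFSphi treeT F0 cF FE.
split=> [A M clA [M0 [psi psiE ME]]|A M U psi clA psiE M0 ME oU QU].
  (* If [A = F], then [M] is itself a miniset of [F], and a constant sequence suffices. *)
  have [AF|Av] := cases A clA.
    exists M => //; apply: miniset_microset => //.
    by rewrite -AF; split=> //; exists psi.
  have [N [mN MN _]] := approximating_microset IFSphi treeT leaflessT FE
    clA.1 Av psiE M0 ME.
  by exists N.
have [AF|Av] := cases A clA.
  by apply: miniset_microset => //; rewrite -AF; split=> //; exists psi.
have [N [mN MN NM]] := approximating_microset IFSphi treeT leaflessT FE
  clA.1 Av psiE M0 ME.
by have -> : M = N by apply/seteqP; split=> //; exact: NM oU QU.
Qed.
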